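(* There exists a computable function $f:\mathbb{N}\to\mathbb{N}$ with the following property. Let $\Sigma$ be a finite alphabet and let $X\subseteq \Sigma^{\mathbb{Z}^2}$ be a $\mathbb{Z}^2$-subshift such that for every finite set $P\subseteq \mathbb{Z}^2\setminus\{(0,0)\}$ there is a configuration $x\in X$ that avoids every $p\in P$ (i.e. for each $p\in P$ there is $z\in\mathbb{Z}^2$ with $x_z\neq x_{z+p}$). Then $X$ contains an aperiodic configuration $x$ such that for every $p\in\mathbb{Z}^2\setminus\{(0,0)\}$ there exists $z\in\mathbb{Z}^2$ with $\|z\|_\infty\le f(\|p\|_\infty)$ and $x_z\neq x_{z+p}$.
   Context: A $\mathbb{Z}^2$-subshift is a closed (for the product topology) subset $X\subseteq\Sigma^{\mathbb{Z}^2}$ invariant under all shifts $\sigma_v$, $(\sigma_v(x))_z=x_{z+v}$. A configuration $x$ is periodic with period $v\in\mathbb{Z}^2\setminus\{(0,0)\}$ if $x_z=x_{z+v}$ for all $z$; it is aperiodic if it has no period. For $p\in\mathbb{Z}^2$, a pair $(z,z+p)$ with $x_z\neq x_{z+p}$ is called an avoidance of $p$, and $x$ avoids $p$ if such a pair exists. Norms are the uniform norm $\|\cdot\|_\infty$. *)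

(* Defs.v *)
From HB Require Import structures.
From mathcomp Require Import all_boot all_order all_algebra.
From mathcomp Require Import all_classical.
From mathcomp Require Import topology.

Set Implicit Arguments.
Unset Strict Implicit.
Unset Printing Implicit Defensive.

Import GRing.Theory.
Local Open Scope classical_set_scope.
Local Open Scope ring_scope.

(** Syntax of Kleene's partial (mu-)recursive functions, indexed by arity. *)
Inductive recfun : nat -> Type :=
| RZero n : recfun n
| RSucc : recfun 1
| RProj n (i : 'I_n) : recfun n
| RComp k n (g : recfun k) (h : 'I_k -> recfun n) : recfun n
| RPrec n (g : recfun n) (h : recfun n.+2) : recfun n.+1
| RMu n (g : recfun n.+1) : recfun n.

(** [rec_eval e v y]: the partial function denoted by [e] is defined at [v] and
    takes the value [y] there.
    - [RPrec g h] is the function F with F(0, u) = g(u) and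
      F(i+1, u) = h(i, F(i, u), u); [s] lists the values F(0, u), ..., F(x, u).
    - [RMu g] maps v to the least y with g(y, v) = 0, provided g(i, v) is defined
      (and nonzero) for every i < y. *)
Fixpoint rec_eval n (e : recfun n) : n.-tuple nat -> nat -> Prop :=
  match e in recfun n return n.-tuple nat -> nat -> Prop with
  | RZero _ => fun _ y => y = 0%N
  | RSucc => fun v y => y = (thead v).+1
  | RProj _ i => fun v y => y = tnth v i
  | RComp k _ g h => fun v y =>
      exists w : k.-tuple nat,
        (forall i, rec_eval (h i) v (tnth w i)) /\ rec_eval g w y
  | RPrec n g h => fun v y =>
      let x := thead v in
      let u : n.-tuple nat := [tuple of behead v] in
      exists s : nat -> nat,
        [/\ rec_eval g u (s 0%N),
            forall i, (i < x)%N ->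
              rec_eval h [tuple of i :: s i :: u] (s i.+1)
          & y = s x]
  | RMu _ g => fun v y =>
      rec_eval g [tuple of y :: v] 0%N /\
      forall i, (i < y)%N ->
        exists m : nat, rec_eval g [tuple of i :: v] m.+1
  end.

Definition computable (f : nat -> nat) : Prop :=
  exists e : recfun 1, forall n y : nat, rec_eval e [tuple n] y <-> y = f n.

Notation Z2 := (int * int)%type.

Definition norm_oo (z : Z2) : nat := maxn `|z.1|%N `|z.2|%N.

(** Sigma^(Z^2) with the product topology, Sigma being discrete. *)
Definition config (Sigma : finType) : topologicalType :=
  {ptws Z2 -> discrete_topology Sigma}.

Definition shift (Sigma : finType) (v : Z2) (x : config Sigma) : config Sigma :=
  fun z => x (z + v).

Definition subshift (Sigma : finType) (X : set (config Sigma)) : Prop :=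
  closed X /\ forall v x, X x -> X (shift v x).

Definition is_period (Sigma : finType) (x : config Sigma) (v : Z2) : Prop :=
  v <> 0 /\ forall z : Z2, x z = x (z + v).

Definition aperiodic (Sigma : finType) (x : config Sigma) : Prop :=
  ~ exists v : Z2, is_period x v.

Definition avoids_at (Sigma : finType) (x : config Sigma) (p z : Z2) : Prop :=
  x z <> x (z + p).

Definition avoids (Sigma : finType) (x : config Sigma) (p : Z2) : Prop :=
  exists z : Z2, avoids_at x p z.

(* Main.v *)
(** List the nonzero vectors as q_0, q_1, ... and call a point z k-good for x
    when each q_i with i < k is avoided within a distance r_i of z, where r_i
    depends on i only.  The key fact ([period_or_good]) is that for suitable
    integers N_i every ball either contains a k-good point of x or has a smaller
    concentric ball on which x has the period N_i q_i for some i < k.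

    It is proved by induction on k.  Suppose that there is a k-good point z but
    no (k+1)-good one, and write q = q_k.  Then x is q-periodic around z,
    so z + l q is k-good for every l.  Were N_k q avoided at y, no k-good point
    could be near y, so by induction x has a period N_i q_i around y.  If q_i is
    collinear with q, then N_k q is a multiple of N_i q_i, a contradiction;
    otherwise the avoidance at y can be moved by N_i q_i or its opposite,
    whichever gets closer to the line z + Z q.  Repeating this brings it near
    one of the k-good points z + l q, which would then be (k+1)-good.

    Hence a configuration avoiding every N_i q_i with i < k has a k-good point.
    Shifting it to the origin and letting k tend to infinity, compactness gives
    the required configuration. *)

Require Import Defs.
From HB Require Import structures.
From mathcomp Require Import all_boot all_order all_algebra.
From mathcomp Require Import all_classical.
From mathcomp Require Import topology.
From mathcomp Require Import zify ring.

Set Implicit Arguments.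
Unset Strict Implicit.
Unset Printing Implicit Defensive.

Import GRing.Theory.

Local Open Scope classical_set_scope.
Local Open Scope ring_scope.

Definition dist (u v : Z2) : nat := norm_oo (u - v).

Definition det (u v : Z2) : int := u.1 * v.2 - u.2 * v.1.

Arguments norm_oo z%_ring_scope.
Arguments dist u%_ring_scope v%_ring_scope.
Arguments det u%_ring_scope v%_ring_scope.

Lemma mulz_pair (u : Z2) (c : int) : u *~ c = (u.1 * c, u.2 * c).
Proof.
by rewrite [u *~ c]surjective_pairing (raddfMz fst) (raddfMz snd) !mulrzz.
Qed.

Lemma norm_oo_mulz (u : Z2) (c : int) : norm_oo (u *~ c) = (`|c| * norm_oo u)%N.
Proof. by rewrite mulz_pair /norm_oo /= !abszM -maxnMl mulnC. Qed.

Lemma norm_oo_eq0 (u : Z2) : (norm_oo u == 0%N) = (u == 0).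
Proof. by case: u => a b; rewrite /norm_oo xpair_eqE /=; lia. Qed.

Lemma dist0r (u : Z2) : dist u 0 = norm_oo u.
Proof. by rewrite /dist subr0. Qed.

Lemma distxx (u : Z2) : dist u u = 0%N.
Proof. by rewrite /dist subrr. Qed.

Lemma distC (u v : Z2) : dist u v = dist v u.
Proof. by case: u v => [a b] [c d]; rewrite /dist /norm_oo /=; lia. Qed.

Lemma dist_triangle (v u w : Z2) : (dist u w <= dist u v + dist v w)%N.
Proof. by case: u v w => [a b] [c d] [e f]; rewrite /dist /norm_oo /=; lia. Qed.

Lemma dist_addl (u v : Z2) : dist (u + v) u = norm_oo v.
Proof. by rewrite /dist addrC addKr. Qed.

Lemma dist_add2r (u v w : Z2) : dist (u + w) (v + w) = dist u v.
Proof. by rewrite /dist opprD addrACA subrr addr0. Qed.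

Lemma leq_distD (u v w : Z2) : (dist (u + v) w <= dist u w + norm_oo v)%N.
Proof. by rewrite addnC -(dist_addl u v) dist_triangle. Qed.

Lemma detBl (u v w : Z2) : det (u - v) w = det u w - det v w.
Proof. by case: u v w => [a b] [c d] [e f]; rewrite /det /=; ring. Qed.

Lemma det_mulzl (u v : Z2) (c : int) : det (u *~ c) v = c * det u v.
Proof. by rewrite mulz_pair /det /=; ring. Qed.

Lemma leq_det (u v : Z2) : (`|det u v| <= 2 * norm_oo u * norm_oo v)%N.
Proof.
case: u v => [a b] [c d]; rewrite /det /norm_oo /=.
have ad_le : (`|(a * d)%R| <= maxn `|a| `|b| * maxn `|c| `|d|)%N.
  by rewrite abszM leq_mul ?leq_maxl ?leq_maxr.
have bc_le : (`|(b * c)%R| <= maxn `|a| `|b| * maxn `|c| `|d|)%N.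
  by rewrite abszM leq_mul ?leq_maxl ?leq_maxr.
lia.
Qed.

(* Subtract from u the multiple of q that makes u small in the larger coordinate
   of q; the other coordinate is then controlled by the determinant, which does
   not change when multiples of q are added to u. *)
Lemma reduce_along (u q : Z2) : q != 0 -> exists2 l : int,
  (`|l| <= norm_oo u + 1)%N &
  (norm_oo (u + q *~ l) <= norm_oo q + `|det u q|)%N.
Proof.
wlog q21 : u q / (`|q.2| <= `|q.1|)%N => [reduce q0|].
  have [|/ltnW q12] := leqP `|q.2| `|q.1|; first by move=> ?; exact: reduce.
  have [|//|l l_le red] := reduce (u.2, u.1) (q.2, q.1).
  - by [].
  - by move: q0; case: q {q12} => a b; rewrite !xpair_eqE andbC.
  - exists l; move: l_le red; rewrite !mulz_pair /norm_oo /det /=; lia.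
case: u q q21 => [a b] [c e] /= ec; rewrite xpair_eqE => q0.
have c0 : c != 0 by apply: contraNneq q0 => c0; rewrite c0 in ec *; lia.
move: (divz_eq a c) (modz_ge0 a c0) (ltz_mod a c0).
move: (a %/ c)%Z (a %% c)%Z => l r aE r_ge0 r_lt.
exists (- l); rewrite /norm_oo /=.
  suff : (`|(l * c)%R| <= `|a| + `|c|)%N by rewrite abszM abszN; nia.
  lia.
rewrite mulz_pair /det /=.
have -> : a + c * - l = r by rewrite aE; ring.
suff : (`|(b + e * - l)%R| <= `|c| + `|(a * e - b * c)%R|)%N by lia.
have second_coordM : (b + e * - l) * c = r * e - (a * e - b * c).
  by rewrite aE; ring.
rewrite -(@leq_pmul2r `|c|) -?abszM ?second_coordM; last by lia.
have : (`|(r * e)%R| <= `|c| * `|c|)%N by rewrite abszM leq_mul //; lia.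
have : (`|(a * e - b * c)%R| <= `|(a * e - b * c)%R| * `|c|)%N.
  by rewrite leq_pmulr //; lia.
rewrite mulnDl; lia.
Qed.

Lemma dvdz_mul_fact (d : int) (m n k : nat) :
  d != 0 -> (`|d| <= k)%N -> (m * k`! %| n)%N -> (m%:Z * d %| n%:Z)%Z.
Proof.
move=> d0 dk; apply: dvdn_trans; rewrite abszM dvdn_mul //.
by apply: dvdn_fact; lia.
Qed.

Lemma collinear_multiple (p q : Z2) (m n k : nat) :
  p != 0 -> (norm_oo p <= k)%N -> det p q = 0 -> (m * k`! %| n)%N ->
  exists c : int, q *~ n = p *~ m *~ c.
Proof.
case: p q => [a b] [c d]; rewrite xpair_eqE /norm_oo /det /=.
move=> p0 pk /subr0_eq pq mn.
have [a0|a0] := eqVneq a 0.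
  have b0 : b != 0 by move: p0; rewrite a0.
  have /dvdzP[t nE] : (m%:Z * b %| n%:Z)%Z.
    by apply: dvdz_mul_fact mn => //; lia.
  have /eqP c0 : c == 0.
    by move/eqP: pq; rewrite a0 mul0r eq_sym mulf_eq0 (negPf b0).
  by exists (t * d); rewrite !mulz_pair /= nE a0 c0; congr pair; ring.
have /dvdzP[t nE] : (m%:Z * a %| n%:Z)%Z.
  by apply: dvdz_mul_fact mn => //; lia.
exists (t * c); rewrite !mulz_pair /= nE; congr pair; first by ring.
by rewrite (_ : d * _ = t * m%:Z * (a * d)); [rewrite pq; ring|ring].
Qed.

Section LocalPeriods.
Context {T : Type}.
Implicit Types (x : Z2 -> T) (p v w y z : Z2) (r s : nat).

Definition periodic_on x p s w :=
  forall y, (dist y w <= s)%N -> x y = x (y + p).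

Definition avoided_near x p s w :=
  exists2 y, (dist y w <= s)%N & x y <> x (y + p).

Lemma not_avoided_near x p s w : ~ avoided_near x p s w <-> periodic_on x p s w.
Proof.
split=> [nav y yw|per [y yw]]; last by case; exact: per.
by apply: contrapT => xy; apply: nav; exists y.
Qed.

Lemma periodic_on_sub x p s w r y :
  (dist y w + r <= s)%N -> periodic_on x p s w -> periodic_on x p r y.
Proof.
by move=> rs per z zy; apply: per; have := dist_triangle y z w; lia.
Qed.

Lemma periodic_on_mulz x p (c : int) s w :
  periodic_on x p (s + `|c| * norm_oo p) w -> periodic_on x (p *~ c) s w.
Proof.
elim/int_rect: c => [|n IHn|n IHn] per y yw; first by rewrite mulr0z addr0.
all: rewrite IHn //; last by apply: periodic_on_sub per; rewrite distxx; lia.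
- rewrite per; last first.
    by have := leq_distD y (p *~ n) w; rewrite norm_oo_mulz; lia.
  by rewrite -addrA intS mulrzDr mulr1z [p + _]addrC.
- rewrite [RHS]per; last first.
    by have := leq_distD y (p *~ - n.+1%:Z) w; rewrite norm_oo_mulz; lia.
  by rewrite -addrA intS opprD mulrzDr mulrN1z addrAC addNr add0r.
Qed.

Lemma avoidance_translate x p v s w y :
  periodic_on x v s w -> (dist y w + norm_oo p <= s)%N ->
  x y <> x (y + p) -> x (y + v) <> x (y + v + p).
Proof.
move=> per yw; have ypw := leq_distD y p w.
by rewrite addrAC -(per y) -?(per (y + p)) //; lia.
Qed.

Lemma avoided_near_translate x p v r z :
  periodic_on x v (r + norm_oo p) z -> avoided_near x p r z ->
  avoided_near x p r (z + v).
Proof.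
move=> per [y yz xy]; exists (y + v); first by rewrite dist_add2r.
by apply: avoidance_translate per _ xy; rewrite leq_add2r.
Qed.

End LocalPeriods.

(* The multiplier N_k: it is divisible by a N_i for all i < k and
   0 < a <= i + 1, which makes N_k q_k a multiple of N_i q_i for collinear q_i
   and q_k. *)
Definition multiplier (k : nat) : nat := (k`! ^ k)%N.

Definition period_bound (k : nat) : nat := (multiplier k * k.+1)%N.

(* [radius k] is the ratio of the radii of the two balls in [period_or_good];
   r_k is [radius k.+1]. *)
Fixpoint radius (k : nat) : nat :=
  if k is k'.+1 then (8 * radius k' * period_bound k' * k'.+1 ^ 2)%N else 1%N.

(* At distance [(radius k + 1) * s] from a point of a line of direction q_k, the
   determinant is at most [2 * ((radius k + 1) * s) * k.+1]; each step of the
   descent towards the line lowers it and is at most [period_bound k] long. *)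
Definition descent_reach (k s : nat) : nat :=
  (s + 2 * ((radius k + 1) * s) * k.+1 * period_bound k)%N.

Lemma multiplier_gt0 k : (0 < multiplier k)%N.
Proof. by rewrite expn_gt0 fact_gt0. Qed.

Lemma leq_dvdn_fact m n : (m <= n)%N -> (m`! %| n`!)%N.
Proof. by move=> mn; rewrite (fact_split mn) dvdn_mulr. Qed.

Lemma dvdn_multiplier i k :
  (i < k)%N -> (multiplier i * i.+1`! %| multiplier k)%N.
Proof.
move=> ik; apply: dvdn_trans (dvdn_exp2l _ ik); rewrite expnSr.
by rewrite dvdn_mul ?dvdn_exp2r ?leq_dvdn_fact // ltnW.
Qed.

Lemma leq_multiplier i k : (i <= k)%N -> (multiplier i <= multiplier k)%N.
Proof.
rewrite leq_eqVlt => /predU1P[->//|ik]; apply: dvdn_leq (multiplier_gt0 _) _.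
by apply: dvdn_trans (dvdn_multiplier ik); rewrite dvdn_mulr.
Qed.

Lemma period_bound_gt0 k : (0 < period_bound k)%N.
Proof. by rewrite muln_gt0 multiplier_gt0. Qed.

Lemma radius_gt0 k : (0 < radius k)%N.
Proof. by elim: k => //= k IHk; rewrite !muln_gt0 IHk multiplier_gt0. Qed.

(* These estimates are what determines the recursion of [radius]. *)
Lemma radiusS_bounds k s : (0 < s)%N ->
  [/\ (descent_reach k s + radius k * (2 * period_bound k)
         <= radius k.+1 * s)%N,
      (radius k * s + (radius k * s + descent_reach k s + 1) * k.+1
         <= radius k.+1 * s)%N,
      (radius k * (2 * period_bound k) + period_bound k <= radius k.+1)%N &
      (k.+1 + 2 * period_bound k * k.+1 + period_bound k <= radius k.+1)%N].
Proof.
rewrite /descent_reach /= expnS expn1.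
move: (radius k) (radius_gt0 k) (period_bound k) (period_bound_gt0 k) s.
by case=> // A _ [] // P _ [] // s _; split; lia.
Qed.

Lemma leq_radiusS k : (radius k + 2 * k.+1 <= radius k.+1)%N.
Proof.
rewrite /= expnS expn1.
move: (radius k) (radius_gt0 k) (period_bound k) (period_bound_gt0 k).
by case=> // A _ [] // P _; lia.
Qed.

Lemma leq_radius : {homo radius : i k / (i <= k)%N}.
Proof.
apply: homo_leq => // [i j k|k]; first exact: leq_trans.
by have := leq_radiusS k; lia.
Qed.

Section PeriodOrGood.
Variables (T : Type) (x : Z2 -> T) (q : nat -> Z2).
Hypothesis q_neq0 : forall i, q i != 0.
Hypothesis norm_q : forall i, (norm_oo (q i) <= i.+1)%N.

Lemma leq_dist_along k z (l : int) w :
  (dist (z + q k *~ l) w <= dist z w + `|l| * k.+1)%N.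
Proof.
apply: leq_trans (leq_distD _ _ _) _.
by rewrite norm_oo_mulz leq_add2l leq_mul2l norm_q orbT.
Qed.

Lemma norm_period i k :
  (i <= k)%N -> (norm_oo (q i *~ multiplier i) <= period_bound k)%N.
Proof.
move=> ik; rewrite norm_oo_mulz leq_mul ?leq_multiplier //.
exact: leq_trans (norm_q i) _.
Qed.

Lemma period_neq0 i : q i *~ multiplier i != 0.
Proof.
rewrite -norm_oo_eq0 norm_oo_mulz muln_eq0 norm_oo_eq0 (negPf (q_neq0 i)) orbF.
by have := multiplier_gt0 i; lia.
Qed.

Definition good k z :=
  forall i, (i < k)%N -> avoided_near x (q i) (radius i.+1) z.

Lemma goodS k z :
  good k.+1 z <-> good k z /\ avoided_near x (q k) (radius k.+1) z.
Proof.
split=> [gz|[gz av] i]; first by split=> [i ik|]; apply: gz => //; exact: ltnW.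
by rewrite ltnS leq_eqVlt => /predU1P[->|/gz].
Qed.

Lemma good_translate k v z :
  periodic_on x v (radius k + k) z -> good k z -> good k (z + v).
Proof.
move=> per gz i ik; apply: avoided_near_translate (gz i ik).
apply: periodic_on_sub per; rewrite distxx.
by have := leq_radius ik; have := norm_q i; lia.
Qed.

Definition local_period k s w :=
  exists2 i, (i < k)%N & periodic_on x (q i *~ multiplier i) s w.

Section InductionStep.
Variables (k s : nat) (w : Z2).
Hypothesis period_or_good_k : forall t u, (0 < t)%N ->
  local_period k t u \/ exists2 z, (dist z u <= radius k * t)%N & good k z.
Hypothesis s_gt0 : (0 < s)%N.
Hypothesis no_goodS :
  forall z, (dist z w <= radius k.+1 * s)%N -> ~ good k.+1 z.

Local Notation p := (q k).
Local Notation N := (multiplier k).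
Local Notation P := (period_bound k).

Lemma good_periodic z : good k z -> (dist z w <= radius k.+1 * s)%N ->
  periodic_on x p (radius k.+1) z.
Proof.
move=> gz zw; apply/not_avoided_near => av.
by apply: no_goodS zw _; apply/goodS.
Qed.

Lemma avoidance_far_from_good y z :
  good k z -> (dist z w <= radius k.+1 * s)%N ->
  x y <> x (y + p *~ N) -> (radius k.+1 < dist y z + P)%N.
Proof.
move=> gz zw xy; rewrite ltnNge; apply/negP => yz; apply: xy.
suff per : periodic_on x (p *~ N) (dist y z) z by exact: per.
apply: periodic_on_mulz; apply: periodic_on_sub (good_periodic gz zw).
by rewrite distxx -norm_oo_mulz; have := norm_period (leqnn k); lia.
Qed.

Lemma good_along z (l : int) : good k z ->
  (dist z w + `|l| * k.+1 <= radius k.+1 * s)%N -> good k (z + p *~ l).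
Proof.
move=> gz.
have good_step u (c : int) : (`|c| <= 1)%N -> good k u ->
    (dist u w <= radius k.+1 * s)%N -> good k (u + p *~ c).
  move=> c1 gu uw; apply: (good_translate _ gu); apply: periodic_on_mulz.
  apply: periodic_on_sub (good_periodic gu uw); rewrite distxx.
  by have := leq_radiusS k; have := norm_q k; nia.
elim/int_rect: l => [|n IHn|n IHn] lw; first by rewrite mulr0z addr0.
1: rewrite intS [1 + _]addrC mulrzDr addrA.
2: rewrite intS opprD [-1 + _]addrC mulrzDr addrA.
all: apply: good_step => //; first by apply: IHn; lia.
all: apply: leq_trans (leq_dist_along _ _ _ _) (leq_trans _ lw).
all: by rewrite leq_add2l leq_mul2r; lia.
Qed.

Lemma noncollinear_local_period y :
  (dist y w + radius k * (2 * P) <= radius k.+1 * s)%N ->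
  x y <> x (y + p *~ N) ->
  exists v, [/\ (norm_oo v <= P)%N, det v p != 0 & periodic_on x v (2 * P) y].
Proof.
move=> yw xy; have P_gt0 : (0 < 2 * P)%N by rewrite muln_gt0 period_bound_gt0.
have [[i ik per]|[z zy gz]] := period_or_good_k y P_gt0; last first.
  have [_ _ r_ge _] := radiusS_bounds k s_gt0.
  have zw : (dist z w <= radius k.+1 * s)%N by have := dist_triangle y z w; lia.
  by have := avoidance_far_from_good gz zw xy; rewrite distC; lia.
exists (q i *~ multiplier i); split=> //; first exact/norm_period/ltnW.
rewrite det_mulzl mulf_eq0 negb_or; apply/andP; split.
  by have := multiplier_gt0 i; lia.
apply/eqP => det0; apply: xy.
have [c pN] :=
  collinear_multiple (q_neq0 i) (norm_q i) det0 (dvdn_multiplier ik).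
suff per_c : periodic_on x (p *~ N) 0 y by apply: per_c; rewrite distxx.
rewrite pN; apply: periodic_on_mulz; apply: periodic_on_sub per.
by rewrite distxx -norm_oo_mulz -pN; have := norm_period (leqnn k); lia.
Qed.

Lemma avoidance_step z y :
  (dist y w + radius k * (2 * P) <= radius k.+1 * s)%N ->
  x y <> x (y + p *~ N) -> (2 * P * k.+1 < `|det (z - y) p|)%N ->
  exists y', [/\ (dist y' w <= dist y w + P)%N,
    (`|det (z - y') p| < `|det (z - y) p|)%N & x y' <> x (y' + p *~ N)].
Proof.
move=> yw xy far; have [v [vP v_p per]] := noncollinear_local_period yw xy.
have det_v : (`|det v p| <= 2 * P * k.+1)%N.
  by apply: leq_trans (leq_det _ _) _; rewrite leq_mul ?leq_mul2l.
have [c c1 closer] : exists2 c : int, `|c|%N = 1%N &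
    (`|(det (z - y) p - c * det v p)%R| < `|det (z - y) p|)%N.
  have [closer|] := ltnP `|(det (z - y) p - det v p)%R| `|det (z - y) p|.
    by exists 1; rewrite // mul1r.
  by exists (-1); lia.
exists (y + v *~ c); split.
- apply: leq_trans (leq_distD _ _ _) _.
  by rewrite norm_oo_mulz c1 mul1n leq_add2l.
- by rewrite opprD addrA detBl det_mulzl.
- have per_c : periodic_on x (v *~ c) P y.
    apply: periodic_on_mulz; apply: periodic_on_sub per.
    by rewrite distxx c1; lia.
  by apply: avoidance_translate per_c _ xy; rewrite distxx norm_period.
Qed.

Lemma avoidance_descent z y :
  (dist y w + `|det (z - y) p| * P + radius k * (2 * P) <= radius k.+1 * s)%N ->
  x y <> x (y + p *~ N) ->
  exists y', [/\ (dist y' w <= dist y w + `|det (z - y) p| * P)%N,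
    (`|det (z - y') p| <= 2 * P * k.+1)%N & x y' <> x (y' + p *~ N)].
Proof.
have [n] := ubnP `|det (z - y) p|; elim: n y => // n IHn y det_lt budget xy.
have [near|far] := leqP `|det (z - y) p| (2 * P * k.+1).
  by exists y; split=> //; exact: leq_addr.
have [|y1 [y1w closer xy1]] := avoidance_step _ xy far; first by lia.
have spent : (dist y1 w + `|det (z - y1) p| * P <=
              dist y w + `|det (z - y) p| * P)%N.
  apply: leq_trans (leq_add y1w (leqnn _)) _.
  by rewrite -addnA -mulSn leq_add2l leq_mul.
have [||y2 [y2w near xy2]] := IHn y1 _ _ xy1; [by lia|by lia|].
by exists y2; split=> //; exact: leq_trans spent.
Qed.

Lemma good_near_periodic z : (dist z w <= radius k * s)%N -> good k z ->
  periodic_on x (p *~ N) s w.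
Proof.
move=> zw gz; apply/not_avoided_near => -[y yw xy].
have [budget line_le _ r_ge] := radiusS_bounds k s_gt0.
have zy : (dist z y <= (radius k + 1) * s)%N.
  by have := dist_triangle w z y; rewrite (distC w) mulnDl; lia.
have det_y : (`|det (z - y) p| <= 2 * ((radius k + 1) * s) * k.+1)%N.
  by apply: leq_trans (leq_det _ _) _; rewrite leq_mul // leq_mul2l zy.
have det_steps := leq_mul det_y (leqnn P).
have [|y' [y'w near xy']] := @avoidance_descent z y _ xy.
  by apply: leq_trans budget; rewrite leq_add2r leq_add.
have [l l_le red] := reduce_along (z - y') (q_neq0 k).
have ly' : (dist (z + p *~ l) y' <= k.+1 + 2 * P * k.+1)%N.
  by rewrite /dist addrAC; apply: leq_trans red _; rewrite leq_add.
have line_budget : (dist z w + `|l| * k.+1 <= radius k.+1 * s)%N.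
  apply: leq_trans line_le; rewrite leq_add // leq_mul2r /=.
  have := dist_triangle w z y'; rewrite (distC w) => zy'.
  apply: leq_trans l_le _; rewrite leq_add2r -/(dist z y').
  by apply: leq_trans zy' _; rewrite leq_add // (leq_trans y'w) // leq_add.
have line_in_ball : (dist (z + p *~ l) w <= radius k.+1 * s)%N.
  exact: leq_trans (leq_dist_along _ _ _ _) line_budget.
have gzl := good_along gz line_budget.
by have := avoidance_far_from_good gzl line_in_ball xy'; rewrite distC; lia.
Qed.

End InductionStep.

Lemma period_or_good k s w : (0 < s)%N ->
  local_period k s w \/ exists2 z, (dist z w <= radius k * s)%N & good k z.
Proof.
elim: k s w => [|k IHk] s w s_gt0; first by right; exists w; rewrite ?distxx.
have [|no_goodS] :=
  pselect (exists2 z, (dist z w <= radius k.+1 * s)%N & good k.+1 z).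
  by right.
left; have [[i ik per]|[z zw gz]] := IHk s w s_gt0.
  by exists i => //; exact: ltnW.
exists k => //; apply: (good_near_periodic IHk s_gt0 _ zw gz) => u uw gu.
by apply: no_goodS; exists u.
Qed.

Lemma exists_good k :
  (forall i, (i < k)%N -> exists y, x y <> x (y + q i *~ multiplier i)) ->
  exists z, good k z.
Proof.
move=> av; have /fin_all_exists[y xy] (i : 'I_k) := av i (ltn_ord i).
pose s := (\max_(i < k) norm_oo (y i)).+1%N.
have [[i ik per]|[z _ gz]] := period_or_good k 0 (ltn0Sn _ : 0 < s)%N.
  case: (xy (Ordinal ik)); apply: per; rewrite dist0r.
  by apply: leqW; exact: leq_bigmax (Ordinal ik).
by exists z.
Qed.

End PeriodOrGood.

Definition int_of_index (n : nat) : int := if odd n then Negz n./2 else n./2.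

Definition index_of_int (c : int) : nat :=
  if c is Negz n then n.*2.+1 else `|c|.*2.

Lemma index_of_intK : cancel index_of_int int_of_index.
Proof.
by case=> n; rewrite /int_of_index /= odd_double /= ?doubleK // uphalf_double.
Qed.

Lemma leq_index_of_int c : (index_of_int c <= 2 * `|c|)%N.
Proof. by case: c => n /=; lia. Qed.

Lemma leq_int_of_index n : (`|int_of_index n| <= n)%N.
Proof. by rewrite /int_of_index; case: ifP; lia. Qed.

(* The pair (a, b) has the code 2^i 3^j, with i and j the indices of a and b. *)
Definition vector_enum (k : nat) : Z2 :=
  let v := (int_of_index (logn 2 k), int_of_index (logn 3 k)) in
  if v == 0 then (1, 0) else v.

Lemma vector_enum_neq0 k : vector_enum k != 0.
Proof. by rewrite /vector_enum; case: ifPn. Qed.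

Lemma norm_vector_enum k : (norm_oo (vector_enum k) <= k.+1)%N.
Proof.
have norm_le l : (`|int_of_index (logn l k)| <= k.+1)%N.
  apply: leq_trans (leq_int_of_index _) (leqW _).
  by case: k => [|k]; [rewrite logn0|apply: ltnW; exact: ltn_logl].
by rewrite /vector_enum; case: ifP => // _; rewrite /norm_oo geq_max !norm_le.
Qed.

Lemma vector_enum_surj (p : Z2) : p != 0 ->
  exists2 k, (k <= 36 ^ norm_oo p)%N & vector_enum k = p.
Proof.
case: p => a b p0; exists (2 ^ index_of_int a * 3 ^ index_of_int b)%N.
  rewrite (_ : 36 = (2 * 3) ^ 2)%N // -expnM expnMn leq_mul // leq_exp2l //.
    by apply: leq_trans (leq_index_of_int _) _; rewrite leq_mul2l leq_maxl.
  by apply: leq_trans (leq_index_of_int _) _; rewrite leq_mul2l leq_maxr.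
rewrite /vector_enum !lognM ?expn_gt0 // !lognX.
rewrite (_ : logn 2 2 = 1)%N // (_ : logn 2 3 = 0)%N //.
rewrite (_ : logn 3 2 = 0)%N // (_ : logn 3 3 = 1)%N //.
by rewrite !muln1 !muln0 addn0 add0n !index_of_intK (negPf p0).
Qed.

Definition computable_tuple n (F : n.-tuple nat -> nat) : Prop :=
  exists e : recfun n, forall v y, rec_eval e v y <-> y = F v.

Definition computable2 (op : nat -> nat -> nat) : Prop :=
  computable_tuple (fun v : 2.-tuple nat => op (tnth v ord0) (tnth v ord_max)).

Lemma computable_tuple_ext n (F G : n.-tuple nat -> nat) :
  F =1 G -> computable_tuple F -> computable_tuple G.
Proof. by move=> FG [e eF]; exists e => v y; rewrite eF FG. Qed.

Lemma computableP (f : nat -> nat) :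
  computable f <-> computable_tuple (fun v : 1.-tuple nat => f (tnth v ord0)).
Proof.
split=> -[e ef]; exists e; last by move=> n y; exact: ef.
by case/tupleP=> n u y; rewrite tuple0; exact: ef.
Qed.

Lemma computable_proj n (i : 'I_n) : computable_tuple (fun v => tnth v i).
Proof. by exists (RProj i). Qed.

Lemma computable_comp k n (G : k.-tuple nat -> nat)
    (H : 'I_k -> n.-tuple nat -> nat) :
  computable_tuple G -> (forall i, computable_tuple (H i)) ->
  computable_tuple (fun v => G [tuple H i v | i < k]).
Proof.
move=> [g gG] /fin_all_exists[h hH]; exists (RComp g h) => v y /=; split.
  move=> [w [hw /gG ->]]; congr G; apply: eq_from_tnth => i.
  by rewrite tnth_mktuple; apply/hH.
move=> ->; exists [tuple H i v | i < k]; split; last exact/gG.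
by move=> i; apply/hH; rewrite tnth_mktuple.
Qed.

Lemma computable_comp1 n (g : nat -> nat) (F : n.-tuple nat -> nat) :
  computable g -> computable_tuple F -> computable_tuple (g \o F).
Proof.
move=> /computableP cg cF.
apply: computable_tuple_ext (computable_comp cg (fun=> cF)) => v.
by rewrite tnth_mktuple.
Qed.

Lemma computable_comp2 n (op : nat -> nat -> nat) (F G : n.-tuple nat -> nat) :
  computable2 op -> computable_tuple F -> computable_tuple G ->
  computable_tuple (fun v => op (F v) (G v)).
Proof.
move=> cop cF cG.
have cFG (i : 'I_2) : computable_tuple (if i == ord0 then F else G).
  by case: ifP.
apply: computable_tuple_ext (computable_comp cop cFG) => v.
by rewrite !tnth_mktuple.
Qed.

Lemma computable_succn : computable succn.
Proof. by apply/computableP; exists RSucc. Qed.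

Lemma computable_cst n (c : nat) : computable_tuple (fun _ : n.-tuple nat => c).
Proof.
elim: c => [|c IHc]; first by exists (RZero n).
exact: computable_comp1 computable_succn IHc.
Qed.

Lemma computable_prec n (F : n.+1.-tuple nat -> nat)
    (G : n.-tuple nat -> nat) (H : n.+2.-tuple nat -> nat) :
  computable_tuple G -> computable_tuple H ->
  (forall u : n.-tuple nat, F [tuple of 0%N :: u] = G u) ->
  (forall i (u : n.-tuple nat),
    F [tuple of i.+1 :: u] = H [tuple of i :: F [tuple of i :: u] :: u]) ->
  computable_tuple F.
Proof.
move=> [g gG] [h hH] F0 FS; exists (RPrec g h) => v y /=.
set u := [tuple of behead v].
have -> : F v = F [tuple of thead v :: u] by rewrite -tuple_eta.
split=> [[s [/gG s0 sS ->]]|->].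
  suff sF i : (i <= thead v)%N -> s i = F [tuple of i :: u] by exact: sF.
  elim: i => [|i IHi] iv; first by rewrite s0 F0.
  by move/hH: (sS i iv) => ->; rewrite FS IHi // ltnW.
exists (fun i => F [tuple of i :: u]); split=> //; first exact/gG.
by move=> i _; apply/hH; rewrite FS.
Qed.

Lemma computable_rec (f : nat -> nat) (h : nat -> nat -> nat) :
  computable2 h -> (forall i, f i.+1 = h i (f i)) -> computable f.
Proof.
move=> ch fS; apply/computableP.
apply: computable_prec (computable_cst 0 (f 0%N)) ch _ _ => // i u.
exact: fS.
Qed.

Lemma computable2_rec (f : nat -> nat -> nat) (g : nat -> nat)
    (h : nat -> nat -> nat) :
  computable g -> computable2 h -> (forall a, f 0%N a = g a) ->
  (forall i a, f i.+1 a = h (f i a) a) -> computable2 f.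
Proof.
move=> /computableP cg ch f0 fS.
have ch_tail := computable_comp2 ch (computable_proj (lift ord0 (@ord0 1)))
  (computable_proj (@ord_max 2)).
apply: computable_prec cg ch_tail _ _ => [u|i u].
  by rewrite f0 !(tnth_nth 0%N).
by rewrite fS !(tnth_nth 0%N).
Qed.

Lemma computable_addn : computable2 addn.
Proof.
apply: (computable2_rec (g := id) (h := fun y _ => y.+1)) => //.
  exact/computableP/computable_proj.
exact: computable_comp1 computable_succn (computable_proj _).
Qed.

Lemma computable_muln : computable2 muln.
Proof.
apply: (computable2_rec (g := fun=> 0%N) (h := addn)) => //.
- exact/computableP/computable_cst.
- exact: computable_addn.
- by move=> i a; rewrite mulSn addnC.
Qed.

Lemma computable_expn : computable2 (fun n m => m ^ n)%N.
Proof.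
apply: (computable2_rec (g := fun=> 1%N) (h := muln)) => //.
- exact/computableP/computable_cst.
- exact: computable_muln.
- by move=> i a; rewrite expnSr.
Qed.

Lemma computable_fact : computable factorial.
Proof.
apply: (computable_rec (h := fun i y => i.+1 * y)%N) => //.
apply: computable_comp2 computable_muln _ (computable_proj _).
exact: computable_comp1 computable_succn (computable_proj _).
Qed.

Lemma computable_multiplier : computable multiplier.
Proof.
apply/computableP.
apply: computable_comp2 computable_expn (computable_proj _) _.
exact: computable_comp1 computable_fact (computable_proj _).
Qed.

Lemma computable_period_bound : computable period_bound.
Proof.
apply/computableP; apply: (computable_comp2 computable_muln).
  exact: computable_comp1 computable_multiplier (computable_proj _).
exact: computable_comp1 computable_succn (computable_proj _).
Qed.

Lemma computable_radius : computable radius.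
Proof.
apply: (computable_rec
  (h := fun i y => 8 * y * period_bound i * i.+1 ^ 2)%N) => //.
apply: (computable_comp2 computable_muln).
  apply: (computable_comp2 computable_muln).
    apply: (computable_comp2 computable_muln) (computable_proj _).
    exact: computable_cst.
  exact: computable_comp1 computable_period_bound (computable_proj ord0).
apply: (computable_comp2 computable_expn (computable_cst _ _)).
exact: computable_comp1 computable_succn (computable_proj ord0).
Qed.

Lemma computable_avoidance_bound : computable (fun n => radius (36 ^ n).+1).
Proof.
apply/computableP; apply: computable_comp1 computable_radius _.
apply: computable_comp1 computable_succn _.
apply: computable_comp2 computable_expn (computable_proj _) _.
exact: computable_cst.
Qed.

Lemma compact_nested_closed (S : topologicalType) (K : set S)
    (F : nat -> set S) :
  compact K -> (forall n, closed (F n)) ->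
  {homo F : m n / (m <= n)%N >-> n `<=` m} ->
  (forall n, K `&` F n !=set0) -> K `&` \bigcap_n F n !=set0.
Proof.
move=> cK clF subF /choice[u KFu].
have [|x [Kx cx]] := cK (u @ \oo) _.
  by exists 0%N => // n _; have [] := KFu n.
exists x; split=> // n _; apply: clF => B xB; apply: cx => //.
by exists n => // m /= nm; apply: subF nm _ _; have [] := KFu m.
Qed.

Lemma finite_ball (w : Z2) (r : nat) : finite_set [set z | (dist z w <= r)%N].
Proof.
case: w => a b; pose offset (c : int) (i : nat) : int := c - r%:Z + i%:Z.
have fin := finite_image2 (fun i j => (offset a i, offset b j))
  (finite_II (2 * r).+1) (finite_II (2 * r).+1).
apply: sub_finite_set fin => -[c d]; rewrite /dist /norm_oo /= => cd.
exists `|(c - a + r%:Z)%R|%N; first by rewrite /=; lia.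
exists `|(d - b + r%:Z)%R|%N; first by rewrite /=; lia.
by rewrite /offset; congr pair; lia.
Qed.

Section Configurations.
Variable Sigma : finType.
Implicit Types (x : config Sigma) (q : nat -> Z2) (p u v w z : Z2).

Lemma compact_config : compact [set: config Sigma].
Proof.
have cSigma : compact [set: discrete_topology Sigma].
  by apply: finite_compact; exact: (@finite_finset Sigma).
have := @tychonoff Z2 (fun=> discrete_topology Sigma) _ (fun=> cSigma).
by congr compact; apply/seteqP; split.
Qed.

Lemma nbhs_coordinate x z : nbhs x [set y : config Sigma | y z = x z].
Proof.
have proj_z := @proj_continuous _ (fun=> discrete_topology Sigma) z x.
exact: proj_z (discrete_set1 _).
Qed.

Lemma closed_neq u v : closed [set x : config Sigma | x u <> x v].
Proof.
rewrite closedC openE => x xuv.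
apply: filterS (filterI (nbhs_coordinate x u) (nbhs_coordinate x v)) => y.
by move=> [/= -> ->].
Qed.

Lemma closed_avoided_near p s w :
  closed [set x : config Sigma | avoided_near x p s w].
Proof.
rewrite (_ : [set x | _] = \bigcup_(y in [set y | (dist y w <= s)%N])
    [set x : config Sigma | x y <> x (y + p)]).
  by apply: closed_bigcup => [|y _]; [exact: finite_ball|exact: closed_neq].
by apply/seteqP; split=> x [y yw xy]; exists y.
Qed.

Lemma closed_good q k z : closed [set x : config Sigma | good x q k z].
Proof.
rewrite (_ : [set x | _] = \bigcap_(i in `I_k)
    [set x : config Sigma | avoided_near x (q i) (radius i.+1) z]) //.
by apply: closed_bigI => i _; exact: closed_avoided_near.
Qed.

Lemma good_limit (X : set (config Sigma)) q z :
  closed X -> (forall k, exists2 x, X x & good x q k z) ->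
  exists2 x, X x & forall k, good x q k z.
Proof.
move=> clX goodX.
have cX := subclosed_compact clX compact_config (@subsetT _ X).
have [|k|x [Xx gx]] := compact_nested_closed cX (@closed_good q ^~ z).
- by move=> m n mn x gx i im; apply: gx; exact: leq_trans mn.
- by have [x Xx gx] := goodX k; exists x.
- by exists x => // k; exact: gx.
Qed.

Lemma good_shift x q k z : good x q k z -> good (shift z x) q k 0.
Proof.
move=> gz i ik; have [y yz xy] := gz i ik.
exists (y - z); first by rewrite dist0r.
by rewrite /shift subrK [_ + q i + z]addrAC subrK.
Qed.

Lemma exists_good_config (X : set (config Sigma)) q :
  (forall i, q i != 0) -> (forall i, (norm_oo (q i) <= i.+1)%N) -> subshift X ->
  (forall P : set Z2, finite_set P -> ~ P 0 ->
    exists x, X x /\ forall p, P p -> avoids x p) ->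
  exists2 x, X x & forall k, good x q k 0.
Proof.
move=> q_neq0 norm_q [clX shX] avX; apply: good_limit => // k.
have [||x [Xx avx]] := avX [set q i *~ multiplier i | i in `I_k].
- exact/finite_image/finite_II.
- by move=> [i _ /eqP]; rewrite (negPf (period_neq0 q_neq0 i)).
have [i ik|z gz] := exists_good (x := x) (k := k) q_neq0 norm_q.
  by apply: avx; exists i.
by exists (shift z x); [exact: shX|exact: good_shift].
Qed.

Lemma good_vector_enum_avoids x p :
  (forall k, good x vector_enum k 0) -> p != 0 ->
  exists2 z, (norm_oo z <= radius (36 ^ norm_oo p).+1)%N & avoids_at x p z.
Proof.
move=> gx /vector_enum_surj[k k_le kp]; rewrite -kp in k_le *.
have [z zr xz] := gx k.+1 k (ltnSn k); exists z => //.
by rewrite -(dist0r z); apply: leq_trans zr _; exact: leq_radius.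
Qed.

End Configurations.

Theorem theorem1 :
  exists f : nat -> nat, computable f /\
    forall (Sigma : finType) (X : set (config Sigma)),
      subshift X ->
      (forall P : set Z2, finite_set P -> ~ P 0 ->
         exists x : config Sigma, X x /\ forall p : Z2, P p -> avoids x p) ->
      exists x : config Sigma,
        [/\ X x,
            aperiodic x
          & forall p : Z2, p <> 0 ->
              exists z : Z2,
                (norm_oo z <= f (norm_oo p))%N /\ avoids_at x p z].
Proof.
exists (fun n => radius (36 ^ n).+1).
split; first exact: computable_avoidance_bound.
move=> Sigma X shiftX avX.
have [x Xx gx] :=
  exists_good_config vector_enum_neq0 norm_vector_enum shiftX avX.
exists x; split=> // [[v [/eqP v0 xv]]|p /eqP p0].
  by have [z _ []] := good_vector_enum_avoids gx v0; exact: xv.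
by have [z zr xz] := good_vector_enum_avoids gx p0; exists z.
Qed.
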